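(* For each $t\in\mathbb N=\{1,2,\dots\}$ let $F_t=(1-\alpha_t)I+\alpha_t T_t:\mathcal D\to\mathcal D$ be a contractive mapping, where $\alpha_t\in(0,1)$ and $T_t:\mathcal D\to\mathcal D$. Let $\{x_t^\star\}\subset\mathcal D$ be the trajectory of fixed points, $x_t^\star=F_t(x_t^\star)$ for each $t$, and let $\{\sigma_t\}$ be finite non-negative scalars with $\|x_{t+1}^\star-x_t^\star\|\le\sigma_t$ for all $t$. For each $t$, let $\hat T_t:\mathcal D\to\mathcal D$ be a map (an approximation of $T_t$), put $\hat F_t:=(1-\alpha_t)I+\alpha_t\hat T_t$, and suppose that for each $t$: (1) there is a scalar $e_t<+\infty$ with $\max_{x\in\mathcal D}\|T_t(x)-\hat T_t(x)\|\le e_t$; (2) there is a scalar $0\le L_t\le 1$ with $\|F_t(x)-F_t(x')\|\le L_t\|x-x'\|$ for all $x,x'\in\mathcal D$; (3) there is a scalar $M_t<+\infty$ with $\max_{x\in\mathcal D}\|F_t(x)\|\le M_t$ and $\max_{x\in\mathcal D}\|\hat F_t(x)\|\le M_t$. Let $\{x_t\}$ be a sequence generated, from an initial point $x_1\in\mathcal D$, by the algorithm $$x_t=\hat F_t(x_{t-1})=(1-\alpha_t)x_{t-1}+\alpha_t\hat T_t(x_{t-1}).$$ Then, at each time $t$, $$\|x_{t+1}-x_{t+1}^\star\|\le c^{(t,0)}\|x_1-x_1^\star\|+\sum_{\tau=1}^t c^{(t,\tau)}(\alpha_\tau e_\tau+\sigma_\tau),$$ where $c^{(t,\tau)}:=\prod_{\ell=\tau+1}^t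 L_\ell$ for $\tau=0,\dots,t-1$ and $c^{(t,t)}:=1$. Suppose further that (2) holds with $L_t<1$ for all $t$. Then $\{x_t^\star\}$ is unique and the following asymptotic bound holds for the algorithm: $$\limsup_{t\to\infty}\|x_t-x_t^\star\|\le\frac{\gamma}{1-L},$$ where $\gamma:=\alpha e+\sigma$, $L:=\sup_t L_t$, $\alpha:=\sup_t\alpha_t$, $e:=\sup_t e_t$ and $\sigma:=\sup_t\sigma_t$.
   Context: The ambient space is $\mathbb R^m$ with norm $\|\cdot\|$, and $\mathcal D\subseteq\mathbb R^m$ is a nonempty closed convex set. $I$ is the identity operator. A mapping $F:\mathcal D\to\mathcal D$ is contractive (a contraction) if it is Lipschitz on $\mathcal D$ with some constant strictly less than $1$.
   Formalization: The displayed finite-time bound is false for x_t=F̂_t(x_{t-1}) from x_1; it is proved for x_{t+1}=F̂_t(x_t), and for the literal recursion with the indices of L, α, e raised by one. The limsup bound excludes the undefined case γ=0, sup L_t=1 (0/0). *)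

(* Defs.v *)
From HB Require Import structures.
From mathcomp Require Import all_boot all_order all_algebra.
From mathcomp Require Import all_classical all_reals all_analysis.

Set Implicit Arguments.
Unset Strict Implicit.
Unset Printing Implicit Defensive.

Import Order.TTheory GRing.Theory Num.Theory.
Import numFieldNormedType.Exports.

Local Open Scope classical_set_scope.
Local Open Scope ring_scope.

(* The instance norm of 'rV[R]_m is the sup norm.  The results hold for any
   norm on R^m, so the norm is an explicit function; as all norms on R^m are
   equivalent, [closed] may refer to the instance topology. *)
Definition is_norm (R : realType) (m : nat) (nrm : 'rV[R]_m -> R) : Prop :=
  [/\ forall x, 0 <= nrm x,
      forall x, nrm x = 0 -> x = 0,
      forall (a : R) x, nrm (a *: x) = `|a| * nrm x &
      forall x y, nrm (x + y) <= nrm x + nrm y].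

Definition lipschitz_wrt (R : realType) (m : nat) (nrm : 'rV[R]_m -> R)
    (D : set 'rV[R]_m) (k : R) (F : 'rV[R]_m -> 'rV[R]_m) : Prop :=
  forall x x', D x -> D x' -> nrm (F x - F x') <= k * nrm (x - x').

Definition contractive_wrt (R : realType) (m : nat) (nrm : 'rV[R]_m -> R)
    (D : set 'rV[R]_m) (F : 'rV[R]_m -> 'rV[R]_m) : Prop :=
  exists2 q : R, 0 <= q < 1 & lipschitz_wrt nrm D q F.

Definition relax (R : realType) (m : nat) (a : R)
    (T : 'rV[R]_m -> 'rV[R]_m) (x : 'rV[R]_m) : 'rV[R]_m :=
  (1 - a) *: x + a *: T x.

(* Time starts at 1: values at index 0 are irrelevant throughout.  Two ways of
   indexing an iteration started at [x 1]: the map [G t] either produces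
   [x t.+1] from [x t], so that [G 1] is used first, or it produces [x t] from
   [x t.-1], so that [G 2] is used first. *)
Definition applied_at (V : Type) (G : nat -> V -> V) (x : nat -> V) : Prop :=
  forall t, (0 < t)%N -> x t.+1 = G t (x t).

Definition produces_at (V : Type) (G : nat -> V -> V) (x : nat -> V) : Prop :=
  forall t, (1 < t)%N -> x t = G t (x t.-1).

Definition cprod (R : realType) (L : nat -> R) (t tau : nat) : R :=
  \prod_(tau.+1 <= l < t.+1) L l.

(* Taken in \bar R, since the sequence may be unbounded. *)
Definition tsup (R : realType) (u : nat -> R) : \bar R :=
  ereal_sup [set (u t)%:E | t in [set t | (0 < t)%N]].

(* Main.v *)
Require Import Defs.
From HB Require Import structures.
From mathcomp Require Import all_boot all_order all_algebra.
From mathcomp Require Import all_classical all_reals all_analysis.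
From mathcomp Require Import ring lra.

Set Implicit Arguments.
Unset Strict Implicit.
Unset Printing Implicit Defensive.

Import Order.TTheory GRing.Theory Num.Theory.
Import numFieldNormedType.Exports.

Local Open Scope classical_set_scope.
Local Open Scope ring_scope.

(** The distance to the moving target, [d t = nrm (x t - xs t)], obeys a scalar
    affine recursion, and everything is read off from that recursion.

    Two perturbations act on [d] at each step.  Replacing [T] by [That] inside
    the relaxation moves the image of a point by at most [alpha t * e t], since
    the two relaxed maps differ by [alpha t] times the difference of [T] and
    [That]; together with the Lipschitz bound of [F t] around its own fixed
    point this is [relax_approx_step].  The target then moves by at most
    [sigma t].  Hence [d t.+1 <= l t * d t + b t], where
    - [l = L] and [b t = alpha t * e t + sigma t] if [Fhat t] sends [x t] to
      [x t.+1]: the map is applied before the target moves;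
    - [l t = L t.+1] and [b t = alpha t.+1 * e t.+1 + sigma t] if [Fhat t.+1]
      does: the target moves first, so the drift is even multiplied by
      [L t.+1 <= 1].
    Convexity of [D] is what keeps the iterates in [D], where these estimates
    hold.

    Unrolling the recursion ([recursion_unroll]) gives both finite-time bounds.
    Bounding its coefficients by the suprema [k] and [g] gives
    [d t.+1 <= k * d t + g]; if [k < 1] and [g] is finite, the excess of [d] over
    the equilibrium [g / (1 - k)] is dominated by a geometric sequence
    ([limn_esup_affine]).  In the remaining cases the asserted bound is [+oo],
    apart from the indeterminate [0 * +oo], which the statement sets aside
    ([limn_esup_recursion]).  A fixed point of [F t] is unique as soon as
    [L t < 1]. *)

Section Norm.
Variables (R : realType) (m : nat) (nrm : 'rV[R]_m -> R).
Hypothesis nrmP : is_norm nrm.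
Implicit Types (D : set 'rV[R]_m) (G T S : 'rV[R]_m -> 'rV[R]_m).

Lemma norm_triangle x y z : nrm (x - z) <= nrm (x - y) + nrm (y - z).
Proof.
have [_ _ _ nrmD] := nrmP.
by apply: le_trans (nrmD _ _); rewrite addrA subrK.
Qed.

Lemma norm_distC x y : nrm (x - y) = nrm (y - x).
Proof.
have [_ _ nrmZ _] := nrmP.
by rewrite -opprB -scaleN1r nrmZ normrN1 mul1r.
Qed.

Lemma lipschitz_wrt_fixed_unique D G (k : R) x y :
  k < 1 -> lipschitz_wrt nrm D k G -> D x -> D y ->
  x = G x -> y = G y -> x = y.
Proof.
have [nrm_ge0 nrm_eq0 _ _] := nrmP.
move=> k1 Gk Dx Dy Gx Gy; have := Gk _ _ Dx Dy; rewrite -Gx -Gy => le_k.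
have le0 : (1 - k) * nrm (x - y) <= 0 by rewrite mulrBl mul1r subr_le0.
have nrm0 : nrm (x - y) = 0.
  apply/eqP; rewrite eq_le nrm_ge0 andbT.
  by move: le0; rewrite pmulr_rle0 ?subr_gt0.
by apply/eqP; rewrite -subr_eq0 (nrm_eq0 _ nrm0).
Qed.

Lemma norm_relaxB (a eps : R) T S x :
  0 <= a -> nrm (T x - S x) <= eps ->
  nrm (relax a T x - relax a S x) <= a * eps.
Proof.
have [_ _ nrmZ _] := nrmP; move=> a0 TS.
rewrite /relax opprD addrACA subrr add0r -scalerBr nrmZ ger0_norm //.
exact: ler_wpM2l.
Qed.

(** The inexact step is compared with the exact one from the same point [x], so
    the approximation error of [S] is needed at [x] only, and is damped by
    [a]. *)
Lemma relax_approx_step D (a k eps : R) T S x y :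
  0 <= a -> lipschitz_wrt nrm D k (relax a T) -> nrm (T x - S x) <= eps ->
  D x -> D y -> y = relax a T y ->
  nrm (relax a S x - y) <= k * nrm (x - y) + a * eps.
Proof.
move=> a0 Tk TS Dx Dy Ty.
apply: le_trans (norm_triangle _ (relax a T x) _) _; rewrite addrC; apply: lerD.
  by rewrite {1}Ty; exact: Tk.
by apply: norm_relaxB => //; rewrite norm_distC.
Qed.

End Norm.

Lemma relax_set_fun (R : realType) (m : nat) (D : set 'rV[R]_m) (a : R)
    (T : 'rV[R]_m -> 'rV[R]_m) :
  convex_set D -> 0 <= a <= 1 -> set_fun D D T -> set_fun D D (relax a T).
Proof.
move=> cD a01 TD x Dx; have /andP[a0 a1] := a01.
have := cD (T x) x (Itv01 a0 a1) (mem_set (TD _ Dx)) (mem_set Dx).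
by move=> /set_mem; rewrite /relax addrC.
Qed.

Section Recursion.
Variable R : realType.
Implicit Types d l b : nat -> R.

Lemma cprod_shift l t tau : cprod (fun i => l i.+1) t tau = cprod l t.+1 tau.+1.
Proof. by rewrite /cprod [RHS]big_add1. Qed.

Lemma cprodS l t tau : (tau <= t)%N -> cprod l t.+1 tau = l t.+1 * cprod l t tau.
Proof. by move=> tau_le; rewrite /cprod big_nat_recr //= mulrC. Qed.

Lemma cprod_diag l t : cprod l t t = 1.
Proof. by rewrite /cprod big_geq. Qed.

(** Discrete Gronwall inequality: the perturbation made at time [tau] reaches
    time [t.+1] multiplied by the later factors [l tau.+1], ..., [l t]. *)
Lemma recursion_unroll d l b :
  (forall t, (0 < t)%N -> 0 <= l t) ->
  (forall t, (0 < t)%N -> d t.+1 <= l t * d t + b t) ->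
  forall t, (0 < t)%N ->
    d t.+1 <= cprod l t 0 * d 1%N + \sum_(1 <= tau < t.+1) cprod l t tau * b tau.
Proof.
move=> l0 dS; elim=> [//|[|t] IH] _.
  by rewrite big_nat1 cprod_diag /cprod big_nat1 mul1r; exact: dS.
apply: le_trans (dS _ _) _ => //.
rewrite big_nat_recr //= cprod_diag mul1r addrA lerD2r cprodS // -mulrA.
under eq_big_nat => tau /andP[_ tau_le] do
  rewrite cprodS ?(ltnW tau_le) // -mulrA.
rewrite -mulr_sumr -mulrDr ler_wpM2l ?l0 //.
exact: IH.
Qed.

Lemma limn_esup_le_eps d (B : R) :
  (forall eps, 0 < eps -> \forall t \near \oo, d t <= B + eps) ->
  (limn_esup (fun t => (d t)%:E) <= B%:E)%E.
Proof.
move=> dB; apply/lee_addgt0Pr => eps eps0.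
apply: ge_ereal_inf; eexists; first by exists [set t | d t <= B + eps] => //; exact: dB.
by apply: ge_ereal_sup => _ [t /= dt <-]; rewrite -EFinD lee_fin.
Qed.

(** The affine map [r |-> k * r + g] contracts towards its fixed point
    [g / (1 - k)], so the excess of [d] over it shrinks at least as fast as
    [k ^+ t]. *)
Lemma limn_esup_affine d (k g : R) :
  0 <= k < 1 -> (forall t, (0 < t)%N -> d t.+1 <= k * d t + g) ->
  (limn_esup (fun t => (d t)%:E) <= (g / (1 - k))%:E)%E.
Proof.
move=> /andP[k0 k1] dS; set B := g / (1 - k).
have Bfix : B = k * B + g.
  by rewrite {}/B; field; rewrite subr_eq0 eq_sym lt_eqF.
have dgeo t : d t.+1 - B <= `|d 1%N - B| * k ^+ t.
  elim: t => [|t IH]; first by rewrite expr0 mulr1 ler_norm.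
  rewrite exprS mulrCA; apply: le_trans (ler_wpM2l k0 IH).
  rewrite mulrBr.
  by have := dS t.+1 isT; lra.
apply: limn_esup_le_eps => eps eps0.
have kn : `|k| < 1 by rewrite ger0_norm.
have /cvgrPdist_lt /(_ _ eps0) := cvg_geometric `|d 1%N - B| kn.
move=> [N _ HN]; exists N.+1 => // -[//|t] /= Nt.
have := HN t Nt; rewrite /= sub0r normrN ger0_norm /geometric /=; last first.
  by rewrite mulr_ge0 // exprn_ge0.
by have := dgeo t; lra.
Qed.

(** Extended-real form, for coefficients bounded by suprema that may be
    degenerate.  The inverse of [0] is [+oo], so for [k = 1] the right-hand side
    is [+oo] when [g] is positive, but [0 * +oo = 0] when [g] is null: that pair
    must be excluded, since then [d] need only be nonincreasing. *)
Lemma limn_esup_recursion d l b (k g : \bar R) :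
  (forall t, 0 <= d t) -> (forall t, (0 < t)%N -> 0 <= l t) ->
  (forall t, (0 < t)%N -> ((l t)%:E <= k)%E) -> (k <= 1)%E ->
  (forall t, (0 < t)%N -> ((b t)%:E <= g)%E) -> (0 <= g)%E ->
  ~ (g = 0%E /\ k = 1%E) ->
  (forall t, (0 < t)%N -> d t.+1 <= l t * d t + b t) ->
  (limn_esup (fun t => (d t)%:E) <= g / (1 - k))%E.
Proof.
move=> d0 l0 lk k1 bg g0 gk dS.
have k0 : (0 <= k)%E by apply: le_trans (lk 1%N isT); rewrite lee_fin l0.
case: k => [k||//] in lk k1 gk k0 *; last by [].
rewrite !lee_fin in k0 k1.
have [kE|kN1] := eqVneq k 1.
  have g_gt0 : (0 < g)%E.
    by rewrite lt_neqAle g0 andbT eq_sym; apply/eqP => gE; apply: gk; rewrite gE kE.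
  by rewrite kE subee // inve0 gt0_muley // leey.
have k_lt1 : k < 1 by rewrite lt_neqAle kN1.
rewrite -EFinB inver subr_eq0 eq_sym (negbTE kN1).
case: g => [g||//] in bg g0 gk *; last first.
  by rewrite gt0_mulye ?leey // lte_fin invr_gt0 subr_gt0.
rewrite -EFinM; apply: limn_esup_affine; first by rewrite k0.
move=> t t0; apply: le_trans (dS t t0) _; apply: lerD.
  by rewrite ler_wpM2r // -lee_fin lk.
by rewrite -lee_fin bg.
Qed.

Lemma tsup_ub (u : nat -> R) t : (0 < t)%N -> ((u t)%:E <= tsup u)%E.
Proof. by move=> t0; apply: ereal_sup_ubound; exists t. Qed.

Lemma tsup_ge0 (u : nat -> R) :
  (forall t, (0 < t)%N -> 0 <= u t) -> (0 <= tsup u)%E.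
Proof. by move=> u0; apply: le_trans (tsup_ub u (ltnSn 0)); rewrite lee_fin u0. Qed.

End Recursion.

Theorem theorem2 (R : realType) (m : nat) (nrm : 'rV[R]_m -> R)
  (D : set 'rV[R]_m) (alpha sigma e L M : nat -> R)
  (T That : nat -> 'rV[R]_m -> 'rV[R]_m) (xs : nat -> 'rV[R]_m) :
  let F := fun t => relax (alpha t) (T t) in
  let Fhat := fun t => relax (alpha t) (That t) in
  is_norm nrm ->
  D !=set0 -> closed D -> convex_set D ->
  (forall t, (0 < t)%N -> 0 < alpha t < 1) ->
  (forall t, (0 < t)%N -> set_fun D D (T t)) ->
  (forall t, (0 < t)%N -> set_fun D D (That t)) ->
  (forall t, (0 < t)%N -> contractive_wrt nrm D (F t)) ->
  (forall t, (0 < t)%N -> D (xs t) /\ xs t = F t (xs t)) ->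
  (forall t, (0 < t)%N -> 0 <= sigma t) ->
  (forall t, (0 < t)%N -> nrm (xs t.+1 - xs t) <= sigma t) ->
  (forall t x, (0 < t)%N -> D x -> nrm (T t x - That t x) <= e t) ->
  (forall t, (0 < t)%N -> 0 <= L t <= 1 /\ lipschitz_wrt nrm D (L t) (F t)) ->
  (forall t x, (0 < t)%N -> D x ->
     nrm (F t x) <= M t /\ nrm (Fhat t x) <= M t) ->
  [/\ forall x : nat -> 'rV[R]_m, D (x 1%N) -> applied_at Fhat x ->
        forall t, (0 < t)%N ->
          nrm (x t.+1 - xs t.+1) <=
            cprod L t 0 * nrm (x 1%N - xs 1%N) +
            \sum_(1 <= tau < t.+1)
               cprod L t tau * (alpha tau * e tau + sigma tau),
      forall x : nat -> 'rV[R]_m, D (x 1%N) -> produces_at Fhat x ->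
        forall t, (0 < t)%N ->
          nrm (x t.+1 - xs t.+1) <=
            cprod L t.+1 1 * nrm (x 1%N - xs 1%N) +
            \sum_(1 <= tau < t.+1)
               cprod L t.+1 tau.+1 *
                 (alpha tau.+1 * e tau.+1 + sigma tau) &
      (forall t, (0 < t)%N -> L t < 1) ->
        (forall y : nat -> 'rV[R]_m,
           (forall t, (0 < t)%N -> D (y t) /\ y t = F t (y t)) ->
           forall t, (0 < t)%N -> y t = xs t) /\
        (let gamma := (tsup alpha * tsup e + tsup sigma)%E in
         ~ (gamma = 0%E /\ tsup L = 1%E) ->
         forall x : nat -> 'rV[R]_m, D (x 1%N) ->
           applied_at Fhat x \/ produces_at Fhat x ->
           (limn_esup (fun t => (nrm (x t - xs t))%:E)
              <= gamma / (1 - tsup L))%E)].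
Proof.
move=> F Fhat nrmP [x0 Dx0] _ cD alpha01 _ ThatD _ fixP sigma0 driftP errP LP _.
have nrm_ge0 v : 0 <= nrm v by have [] := nrmP.
have alpha0 t : (0 < t)%N -> 0 <= alpha t.
  by move=> /alpha01 /andP[/ltW].
have L0 t : (0 < t)%N -> 0 <= L t by move=> /LP [/andP[]].
have e0 t : (0 < t)%N -> 0 <= e t.
  by move=> t0; apply: le_trans (nrm_ge0 _) (errP t x0 t0 Dx0).
have FhatD t : (0 < t)%N -> set_fun D D (Fhat t).
  move=> t0; apply: relax_set_fun => //; last exact: ThatD.
  by have /andP[/ltW -> /ltW ->] := alpha01 t t0.
have fix_step t v : (0 < t)%N -> D v ->
    nrm (Fhat t v - xs t) <= L t * nrm (v - xs t) + alpha t * e t.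
  move=> t0 Dv; have [Dxs xsE] := fixP t t0.
  by apply: (@relax_approx_step _ _ _ nrmP D _ _ _ (T t));
    [exact: alpha0|exact: (LP t t0).2|exact: errP|..].
have applied_rec x : D (x 1%N) -> applied_at Fhat x -> forall t, (0 < t)%N ->
    nrm (x t.+1 - xs t.+1) <=
      L t * nrm (x t - xs t) + (alpha t * e t + sigma t).
  move=> Dx1 xS.
  have Dx t : (0 < t)%N -> D (x t).
    by elim: t => [//|[//|t] IH] _; rewrite xS //; apply: FhatD => //; exact: IH.
  move=> t t0.
  (* drift after the step: pass through xs t, then move the target *)
  rewrite xS // addrA.
  apply: le_trans (norm_triangle nrmP _ (xs t) _) _.
  apply: lerD; first exact: fix_step (Dx _ t0).
  by rewrite (norm_distC nrmP) driftP.
have produces_rec x : D (x 1%N) -> produces_at Fhat x -> forall t, (0 < t)%N ->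
    nrm (x t.+1 - xs t.+1) <=
      L t.+1 * nrm (x t - xs t) + (alpha t.+1 * e t.+1 + sigma t).
  move=> Dx1 xS.
  have Dx t : (0 < t)%N -> D (x t).
    by elim: t => [//|[//|t] IH] _; rewrite xS //; apply: FhatD => //; exact: IH.
  move=> t t0.
  (* drift before the step: the target of Fhat t.+1 is already xs t.+1, so the
     drift enters inside the factor L t.+1, which is dropped as it is <= 1 *)
  rewrite (xS t.+1) //=.
  apply: le_trans (fix_step t.+1 _ _ (Dx _ t0)) _ => //.
  rewrite [X in _ <= _ + X]addrC addrA lerD2r.
  have [/andP[L0t L1t] _] := LP t.+1 isT.
  have xdrift : nrm (xs t - xs t.+1) <= sigma t.
    by rewrite (norm_distC nrmP) driftP.
  apply: le_trans (ler_wpM2l L0t (norm_triangle nrmP _ (xs t) _)) _.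
  rewrite mulrDr lerD2l; apply: le_trans xdrift; exact: ler_piMl.
split.
- move=> x Dx1 xS; apply: (recursion_unroll (d := fun t => nrm (x t - xs t))) => //.
  exact: applied_rec.
- move=> x Dx1 xS t t0.
  have := recursion_unroll (d := fun t => nrm (x t - xs t))
    (fun i _ => L0 i.+1 isT) (produces_rec x Dx1 xS) t0.
  rewrite cprod_shift.
  by under eq_bigr do rewrite cprod_shift.
move=> L1; split.
  move=> y yP t t0; have [Dy yE] := yP t t0; have [Dxs xsE] := fixP t t0.
  exact: (lipschitz_wrt_fixed_unique nrmP (L1 t t0) (LP t t0).2 Dy Dxs).
move=> gamma nondeg x Dx1 xP.
have k1 : (tsup L <= 1)%E.
  by apply: ge_ereal_sup => _ [t /= t0 <-]; rewrite lee_fin ltW ?L1.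
have gamma_ge0 : (0 <= gamma)%E.
  by rewrite adde_ge0 ?mule_ge0 ?tsup_ge0.
have gamma_ub s t : (0 < s)%N -> (0 < t)%N ->
    ((alpha s * e s + sigma t)%:E <= gamma)%E.
  move=> s0 t0; rewrite EFinD EFinM leeD ?tsup_ub //.
  by rewrite lee_pmul ?lee_fin ?alpha0 ?e0 ?tsup_ub.
have [xS|xS] := xP.
  apply: (limn_esup_recursion (d := fun t => nrm (x t - xs t)) (l := L)
    (b := fun t => alpha t * e t + sigma t)) => //.
  - by move=> t; exact: tsup_ub.
  - by move=> t t0; exact: gamma_ub.
  - exact: applied_rec.
apply: (limn_esup_recursion (d := fun t => nrm (x t - xs t))
  (l := fun t => L t.+1) (b := fun t => alpha t.+1 * e t.+1 + sigma t)) => //.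
- by move=> t _; exact: L0.
- by move=> t _; exact: tsup_ub.
- by move=> t t0; exact: gamma_ub.
- exact: produces_rec.
Qed.
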